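(* Let $p$ be a prime and let $\alpha$ be a positive integer not divisible by $p$. For every positive integer $e$ with $p^e>4$, $$\mathrm{u}\big((\alpha p^{e-1})!\big)\equiv(-1)^{p\alpha}\,\mathrm{u}\big((\alpha p^e)!\big)\pmod{p^e}.$$
   Context: For a prime $p$ and a positive integer $n$, $\nu(n)=\nu_p(n)$ denotes the exponent of $p$ in $n$, and $\mathrm{u}(n)=n/p^{\nu(n)}$ denotes the unit part of $n$ with respect to $p$. *)

(* Defs.v *)
From mathcomp Require Import all_boot all_order all_algebra.

Set Implicit Arguments.
Unset Strict Implicit.
Unset Printing Implicit Defensive.

Definition unit_part (p n : nat) : nat := n %/ p ^ logn p n.

(* Main.v *)
Require Import Defs.
From mathcomp Require Import all_boot all_order all_algebra.
From mathcomp Require Import ring zify.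
Import Order.TTheory GRing.Theory Num.Theory.
Local Open Scope ring_scope.

(* Removing the multiples of p from (p N)! leaves p^N N! times the product of
   the integers below p N prime to p. For N = alpha p^(e-1) that product is, mod
   p^e, the alpha-th power of the product of all units of Z/p^e. Pairing each
   unit with its inverse reduces the latter to the product of the square roots
   of 1, which are 1, -1 for odd p (product -1), and 1, -1, h + 1, h - 1 with
   h = 2^(e-1) for p = 2 and e >= 3 (product 1). *)

Lemma unit_partE (p n : nat) : (0 < n)%N -> unit_part p n = (n`_p^')%N.
Proof.
move=> n_gt0; rewrite /unit_part -p_part -{1}(partnC p n_gt0) mulKn //.
Qed.

Lemma unit_partM (p m n : nat) : (0 < m)%N -> (0 < n)%N ->
  unit_part p (m * n) = (unit_part p m * unit_part p n)%N.
Proof. by move=> m0 n0; rewrite !unit_partE ?muln_gt0 ?m0 // partnM. Qed.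

Lemma unit_part_pX (p k : nat) : prime p -> unit_part p (p ^ k) = 1%N.
Proof.
by move=> pr_p; rewrite /unit_part pfactorK // divnn expn_gt0 prime_gt0.
Qed.

Lemma unit_part_id (p n : nat) : prime p -> ~~ (p %| n)%N -> unit_part p n = n.
Proof.
move=> pr_p pn; rewrite /unit_part lognE.
by rewrite (negPf pn) !andbF expn0 divn1.
Qed.

(** Induction on [N]: the new factors are those strictly between [p * N] and [p * N.+1], none a
    multiple of [p], and [p * N.+1] itself, which supplies one more [p] and the factor [N.+1]. *)
Lemma fact_mul_prime (p N : nat) : (0 < p)%N ->
  (p * N)`! = (p ^ N * N`! * \prod_(0 <= k < p * N | ~~ (p %| k)) k)%N.
Proof.
move=> p_gt0; elim: N => [|N IHN]; first by rewrite muln0 big_geq.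
have lt1 : (p * N < p * N.+1)%N by rewrite ltn_pmul2l.
have -> : (p * N.+1)`! =
    ((p * N)`! * \prod_((p * N).+1 <= i < p * N.+1) i * (p * N.+1))%N.
  rewrite !fact_prod (@big_cat_nat _ _ _ (p * N).+1) //=; last by rewrite ltnS ltnW.
  by rewrite [X in (_ * X)%N]big_nat_recr //= mulnA.
rewrite [X in _ = (_ * X)%N](@big_cat_nat _ _ _ (p * N)) //=; last exact: ltnW.
(* The block starts at the index [p * N], which the filter discards. *)
rewrite [X in _ = (_ * (_ * X))%N]big_ltn_cond // dvdn_mulr //=.
have -> : (\prod_((p * N).+1 <= i < p * N.+1 | ~~ (p %| i)) i =
           \prod_((p * N).+1 <= i < p * N.+1) i)%N.
  rewrite big_nat_cond [RHS]big_nat_cond; apply: eq_bigl => i.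
  case: (boolP (_ <= i < _)%N) => //= /andP[l1 l2].
  apply/negP => /dvdnP[q iE]; move: l1 l2.
  by rewrite iE (mulnC q) ltn_pmul2l // ltn_pmul2l // ltnS => /leq_trans/[apply]; rewrite ltnn.
by rewrite IHN factS expnS; ring.
Qed.

Lemma prod_nondiv_ndvd (p a b : nat) : prime p ->
  ~~ (p %| \prod_(a <= k < b | ~~ (p %| k)) k)%N.
Proof.
move=> pr_p; elim/big_rec: _ => [|i x pi px]; first by rewrite dvdn1 neq_ltn prime_gt1 ?orbT.
by rewrite Euclid_dvdM // negb_or pi.
Qed.

Lemma unit_part_fact_mul (p N : nat) : prime p ->
  unit_part p (p * N)`! =
  (unit_part p N`! * \prod_(0 <= k < p * N | ~~ (p %| k)) k)%N.
Proof.
move=> pr_p; have nd := prod_nondiv_ndvd p 0 (p * N) pr_p.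
rewrite fact_mul_prime ?prime_gt0 // unit_partM.
- rewrite unit_partM ?fact_gt0 ?expn_gt0 ?prime_gt0 //.
  by rewrite unit_part_pX // mul1n (unit_part_id _ _ pr_p nd).
- by rewrite muln_gt0 fact_gt0 expn_gt0 prime_gt0.
- by move: nd; case: (\prod_(_ <= _ < _ | _) _)%N => //; rewrite dvdn0.
Qed.

Lemma prod_units_sqrt1 (R : finComUnitRingType) :
  \prod_(x : R | x \is a GRing.unit) x = \prod_(x : R | x ^+ 2 == 1) x.
Proof.
rewrite (bigID (fun x : R => x ^+ 2 == 1)) /=.
have -> : \prod_(x : R | (x \is a GRing.unit) && (x ^+ 2 == 1)) x =
          \prod_(x : R | x ^+ 2 == 1) x.
  apply: eq_bigl => x; case: eqP => [x1|]; rewrite ?andbF ?andbT //.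
  by apply/unitrP; exists x; rewrite -expr2.
rewrite (_ : \prod_(x | _ && _) _ = 1) ?mulr1 //.
(* Stated for any such set closed under inversion, so that induction on cardinality can delete [x]
   and [x^-1] together. *)
suff pairing (A : {set R}) :
    {in A, forall x, [/\ x \is a GRing.unit, x ^+ 2 != 1 & x^-1 \in A]} ->
    \prod_(x in A) x = 1.
  rewrite -[RHS](pairing [set x | (x \is a GRing.unit) && (x ^+ 2 != 1)]).
    by apply: eq_bigl => x; rewrite inE.
  move=> x; rewrite !inE => /andP[xU x2]; split=> //.
  by rewrite unitrV xU exprVn invr_eq1.
have [n] := ubnP #|A|; elim: n A => // n IHn A leAn clA.
have [->|[x xA]] := set_0Vmem A; first by rewrite big_set0.
have [xU x2 xVA] := clA x xA.
have xVx : x^-1 != x.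
  by apply: contra x2 => /eqP xV; rewrite expr2 -{1}xV mulVr.
rewrite (big_setD1 x) //= (big_setD1 x^-1) ?inE ?xVx //= mulrA divrr // mul1r.
apply: IHn.
  rewrite -ltnS; apply: leq_trans leAn; rewrite ltnS.
  by rewrite (cardsD1 x A) xA (cardsD1 x^-1 (A :\ x)) !inE xVx xVA.
move=> y; rewrite !inE => /and3P[yxV yx yA]; have [yU y2 yVA] := clA y yA.
split=> //; rewrite yVA andbT; apply/andP; split.
  by apply: contra yx => /eqP/invr_inj->.
by apply: contra yxV => /eqP <-; rewrite invrK.
Qed.

Lemma natr_Zp_eq0 (m k : nat) : (k%:R == 0 :> 'I_m.+2) = (m.+2 %| k)%N.
Proof. by rewrite Zp_nat -val_eqE. Qed.

Lemma intr_Zp_eq0 (m : nat) (z : int) :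
  (z%:~R == 0 :> 'I_m.+2) = (m.+2%:Z %| z)%Z.
Proof.
case: z => k; first by rewrite dvdzE /= -natr_Zp_eq0.
by rewrite NegzE rmorphN /= oppr_eq0 dvdzE abszN /= -natr_Zp_eq0.
Qed.

(** Factor [x ^+ 2 - 1] on the natural representative of [x]; positivity ensures that the truncated
    [x.-1] really is x - 1. *)
Lemma Zp_sqrt1_dvd (m : nat) (x : 'I_m.+2) : x ^+ 2 = 1 ->
  (0 < x)%N /\ (m.+2 %| x.-1 * x.+1)%N.
Proof.
move=> x2; have xR : (x : nat)%:R = x by exact: (natr_Zp x).
have x_gt0 : (0 < x)%N.
  rewrite lt0n; apply/eqP => x0; move: x2.
  by rewrite -xR x0 expr0n /= => /eqP; rewrite eq_sym oner_eq0.
split=> //; rewrite -natr_Zp_eq0 natrM -natr1 xR -subn1 natrB // xR.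
by apply/eqP; rewrite -subr_sqr x2 expr1n subrr.
Qed.

(** Used with [j] equal to x - 1 or x + 1, to conclude x = 1 or x = -1; the additive form avoids
    truncated subtraction. *)
Lemma Zp_eq_natr (m j : nat) (x : 'I_m.+2) :
  (m.+2 %| j)%N -> forall k l : nat, (x + k = j + l)%N -> x = l%:R - k%:R.
Proof.
move=> dj k l xE; apply/eqP; rewrite eq_sym subr_eq.
have xR : (x : nat)%:R = x by exact: (natr_Zp x).
rewrite -{1}xR -natrD xE natrD.
by move: dj; rewrite -natr_Zp_eq0 => /eqP ->; rewrite add0r.
Qed.

(** An odd prime cannot divide both x - 1 and x + 1, so all of [p ^ e] divides one of them. *)
Lemma prod_sqrt1_odd (p e m : nat) : prime p -> odd p -> m.+2 = (p ^ e)%N ->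
  \prod_(x : 'I_m.+2 | x ^+ 2 == 1) x = -1.
Proof.
move=> pr_p odd_p mE.
have n2 : 1 != -1 :> 'I_m.+2.
  rewrite -subr_eq0 opprK -(natrD _ 1 1) natr_Zp_eq0; apply/negP => d2.
  have om : odd m.+2 by rewrite mE oddX odd_p orbT.
  by have := dvdn_leq (isT : 0 < 2)%N d2; lia.
have s1 : (fun x : 'I_m.+2 => x ^+ 2 == 1) =1 mem [:: 1; -1].
  move=> x; rewrite !inE; apply/eqP/orP => [x2|[]/eqP->]; rewrite ?sqrrN ?expr1n //.
  have [x_gt0 d] := Zp_sqrt1_dvd _ _ x2.
  have {d} : (p ^ e %| x.-1 * x.+1)%N by rewrite -mE.
  have [pd|pd] := boolP (p %| x.-1)%N.
    rewrite Gauss_dvdl.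
      rewrite -mE => d; left; apply/eqP.
      by rewrite -[RHS]subr0; apply: (Zp_eq_natr m x.-1 x d 0 1); lia.
    rewrite coprimeXl // prime_coprime //; apply/negP => pd1.
    have : (p %| x.+1 - x.-1)%N by rewrite dvdn_sub.
    have -> : (x.+1 - x.-1 = 2)%N by lia.
    move/dvdn_leq => /(_ isT); have := prime_gt1 pr_p; lia.
  rewrite Gauss_dvdr ?coprimeXl ?prime_coprime // -mE => d; right; apply/eqP.
  by rewrite -sub0r; apply: (Zp_eq_natr m x.+1 x d 1 0); lia.
rewrite (eq_bigl _ _ s1) -big_uniq /=; last by rewrite inE n2.
by rewrite !big_cons big_nil mulr1 mul1r.
Qed.

(** A root is odd, x = 2c + 1, and 2^e divides 4c(c + 1). As c and c + 1 are coprime, 2^(e-2)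
    divides one of them, so x - 1 or x + 1 is a multiple of h = 2^(e-1). *)
Lemma prod_sqrt1_two (e m : nat) : (3 <= e)%N -> m.+2 = (2 ^ e)%N ->
  \prod_(x : 'I_m.+2 | x ^+ 2 == 1) x = 1.
Proof.
move=> e3 mE; case: e e3 mE => // -[//|[//|f]] _ mE.
have f0 : (0 < 2 ^ f)%N by rewrite expn_gt0.
have mE4 : m.+2 = (8 * 2 ^ f)%N by rewrite mE !expnS; lia.
(* Here f = e - 3, so [h] is half the modulus. *)
pose h : 'I_m.+2 := (4 * 2 ^ f)%:R.
have hh : h + h = 0.
  by apply/eqP; rewrite -natrD natr_Zp_eq0 mE4; apply/dvdnP; exists 1%N; lia.
have h2 : h ^+ 2 = 0.
  apply/eqP; rewrite -natrX natr_Zp_eq0 mE4; apply/dvdnP; exists (2 * 2 ^ f)%N.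
  by ring.
have nz (k : nat) : (0 < k < m.+2)%N -> k%:R != 0 :> 'I_m.+2.
  by case/andP=> k0 km; rewrite natr_Zp_eq0 gtnNdvd.
have hN : - h = h by apply/eqP; rewrite eq_sym -subr_eq0 opprK hh.
(* Up to sign, and since [- h = h], the differences of the four roots are 2, [h] and [h + 2]; their
   nonvanishing makes the list duplicate-free. *)
have two0 : 2%:R != 0 :> 'I_m.+2 by apply: nz; lia.
have h0 : h != 0 by apply: nz; lia.
have hp2 : h + 2%:R != 0 by rewrite -natrD; apply: nz; lia.
(* As [h + h = 0], the only multiples of [h] are 0 and [h]. *)
have hjE (j : nat) : (j * (4 * 2 ^ f))%:R = h *+ odd j.
  rewrite -{1}(odd_double_half j) mulnDl natrD -muln2 -mulnA (natrM _ j./2).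
  have -> : (2 * (4 * 2 ^ f))%:R = 0 :> 'I_m.+2 by rewrite mul2n -addnn natrD.
  by rewrite mulr0 addr0; case: (odd j); rewrite ?mul1n ?mul0n.
have s1 : (fun x : 'I_m.+2 => x ^+ 2 == 1) =1 mem [:: 1; -1; h + 1; h - 1].
  move=> x; rewrite !inE; apply/eqP/idP => [x2|]; last first.
    case/or4P=> /eqP->; rewrite ?sqrrN ?sqrrB ?sqrrD ?h2 ?expr1n ?mulr1 //.
      by rewrite mulr2n hh !add0r.
    by rewrite mulr2n hh subr0 add0r.
  have xR : (x : nat)%:R = x by exact: (natr_Zp x).
  have [x_gt0 d] := Zp_sqrt1_dvd _ _ x2.
  have ox : odd x.
    have : (2 %| x.-1 * x.+1)%N.
      by apply: dvdn_trans d; apply/dvdnP; exists (4 * 2 ^ f)%N; lia.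
    by rewrite Euclid_dvdM // !dvdn2; lia.
  have [c xE] : exists c, (x : nat) = (2 * c).+1.
    by exists (x./2); lia.
  have {d} : (8 * 2 ^ f %| x.-1 * x.+1)%N by rewrite -mE4.
  rewrite xE /=.
  have -> : (2 * c * (2 * c).+2 = 4 * (c * c.+1))%N by ring.
  rewrite (_ : 8 * 2 ^ f = 4 * 2 ^ f.+1)%N; last by rewrite expnS; lia.
  rewrite dvdn_pmul2l //.
  have [oc|ec] := boolP (odd c).
    rewrite Gauss_dvdr ?coprimeXl ?coprime2n // => /dvdnP[j cE].
    have : x + 1 = (j * (4 * 2 ^ f))%:R.
      by rewrite -xR -(natrD _ _ 1); congr (_%:R); rewrite xE; move: cE; rewrite expnS; lia.
    rewrite hjE => /(canRL (addrK _)) ->.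
    by case: (odd j); rewrite ?mulr1n ?mulr0n ?sub0r eqxx ?orbT.
  rewrite Gauss_dvdl ?coprimeXl ?coprime2n //= ?ec // => /dvdnP[j cE].
  have : x = (j * (4 * 2 ^ f))%:R + 1.
    by rewrite -xR -(natrD _ _ 1); congr (_%:R); rewrite xE; move: cE; rewrite expnS; lia.
  rewrite hjE => ->.
  by case: (odd j); rewrite ?mulr1n ?mulr0n ?add0r eqxx ?orbT.
rewrite (eq_bigl _ _ s1) -big_uniq /=.
  rewrite !big_cons big_nil mulr1 mul1r mulN1r mulrC -subr_sqr h2 expr1n sub0r.
  by rewrite opprK.
rewrite !inE !negb_or !andbT; apply/and3P; split; first (apply/and3P; split).
- by rewrite -subr_eq0 opprK -(natrD _ 1 1).
- by rewrite -subr_eq0 opprD addrCA subrr addr0 oppr_eq0.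
- by rewrite -subr_eq0 (_ : _ - _ = - h + 2%:R); [rewrite hN | ring].
- rewrite -[_ == h + 1]subr_eq0 -[_ == h - 1]subr_eq0.
  rewrite (_ : -1 - (h + 1) = - (h + 2%:R)); last by ring.
  rewrite (_ : -1 - (h - 1) = - h); last by ring.
  by rewrite !oppr_eq0 hp2.
- by rewrite -subr_eq0 (_ : h + 1 - (h - 1) = 2%:R) //; ring.
Qed.

(** The filter selects exactly the units. The sign [(-1) ^+ p] covers both parities of [p]; for p =
    2 the bound [4 < p ^ e] gives [3 <= e]. *)
Lemma prod_Zp_units (p e m : nat) :
  prime p -> (0 < e)%N -> (4 < p ^ e)%N -> m.+2 = (p ^ e)%N ->
  \prod_(0 <= k < m.+2 | ~~ (p %| k)%N) k%:R = (-1) ^+ p :> 'I_m.+2.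
Proof.
move=> pr_p e_gt0 pe mE; rewrite big_mkord.
transitivity (\prod_(x : 'I_m.+2 | x \is a GRing.unit) x).
  apply: eq_big => x; last by move=> _; exact: (natr_Zp x).
  rewrite -prime_coprime // -(coprime_pexpl _ _ e_gt0) -mE.
  by rewrite -(@unitZpE m.+2) // (natr_Zp x).
rewrite prod_units_sqrt1 -signr_odd.
have [op|] := boolP (odd p); first by rewrite (prod_sqrt1_odd p e).
have [p2 _|->//] := even_prime pr_p; subst p.
rewrite (prod_sqrt1_two e) ?expr0 //.
by case: e pe {mE e_gt0} => [|[|[|e]]].
Qed.

(** Shifting a block by a multiple of the modulus changes neither residues nor divisibility by
    [p]. *)
Lemma prod_nondiv_periodic (p m a : nat) : (p %| m.+2)%N ->
  \prod_(0 <= k < a * m.+2 | ~~ (p %| k)%N) k%:R =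
  (\prod_(0 <= k < m.+2 | ~~ (p %| k)%N) k%:R) ^+ a :> 'I_m.+2.
Proof.
move=> pm; elim: a => [|a IHa]; first by rewrite mul0n big_geq.
rewrite mulSn (@big_cat_nat _ _ _ (a * m.+2)) ?leq_addl //= IHa exprSr.
congr (_ * _); rewrite -{1}[(a * m.+2)%N]add0n big_addn addnK.
apply: eq_big => [k|k _]; first by rewrite dvdn_addl // dvdn_mull.
rewrite natrD (_ : (a * _)%:R = 0) ?addr0 //.
by apply/eqP; rewrite natr_Zp_eq0 dvdn_mull.
Qed.

Theorem theorem1p1 (p alpha e : nat) (p_prime : prime p)
    (alpha_gt0 : (0 < alpha)%N) (p_ndiv_alpha : ~~ (p %| alpha)%N)
    (e_gt0 : (0 < e)%N) (pe_gt4 : (4 < p ^ e)%N) :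
  ((unit_part p (alpha * p ^ (e - 1))`!)%:Z =
     (-1) ^+ (p * alpha) * (unit_part p (alpha * p ^ e)`!)%:Z
     %[mod (p ^ e)%N%:Z])%Z.
Proof.
(* The ring structure on ['I_m.+2] requires the modulus in this form. *)
have [m mE] : exists m, m.+2 = (p ^ e)%N by exists (p ^ e - 2)%N; lia.
have eE : (alpha * p ^ e = p * (alpha * p ^ (e - 1)))%N.
  by rewrite -{1}(subnK e_gt0) addn1 expnS mulnCA.
have pm : (p %| m.+2)%N by rewrite mE -(prednK e_gt0) expnS dvdn_mulr.
rewrite eE unit_part_fact_mul // -eE.
set u := unit_part _ _; rewrite -mE.
apply/eqP; rewrite eqz_mod_dvd -intr_Zp_eq0 rmorphB rmorphM rmorphXn rmorphN1 /=.
rewrite -!pmulrn natrM natr_prod prod_nondiv_periodic // (prod_Zp_units p e) //.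
(* The sign in the statement meets the equal sign from the product of units, and their square is
   1. *)
by rewrite -exprM mulrCA -expr2 -exprM mulnC exprM sqrrN !expr1n mulr1 subrr.
Qed.
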